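(* Let $n\ge1$ and let $\alpha\in\mathbb{R}$ be such that $\alpha^n,\alpha^{n-1},\dots,\alpha,1$ are linearly independent over $\mathbb{Q}$. Let $B_1,B_2,\dots$ be the Minkowski chain of $(\alpha^n,\alpha^{n-1},\dots,\alpha)\in\mathbb{R}^n$. Then $\alpha$ is algebraic of degree $n+1$ over $\mathbb{Q}$ if and only if the sequence of $n$-tuples $\{B_k(\alpha^n,\alpha^{n-1},\dots,\alpha)\}_{k\ge1}$ takes only finitely many distinct values.
   Context: Minkowski chain: Let $n\ge1$, $\ell=n+1$, $(\alpha_1,\dots,\alpha_n)\in\mathbb{R}^n$ with $\alpha_1,\dots,\alpha_n,1$ linearly independent over $\mathbb{Q}$. For $r=(r_1,\dots,r_\ell)\in\mathbb{Z}^\ell$ put $\xi(r)=r_1\alpha_1+\cdots+r_n\alpha_n+r_\ell$. For a real matrix or vector, $\|\cdot\|_\infty$ is the maximum absolute value of its entries. For $m\in\mathbb{Z}^+$, $A_m$ is the nonsingular integral $\ell\times\ell$ matrix with rows $w_1,\dots,w_\ell$ chosen successively: $w_i$ is the vector $w\in\mathbb{Z}^\ell$ with $\|w\|_\infty\le m$, linearly independent of $w_1,\dots,w_{i-1}$, minimizing $|\xi(w)|$, normalized so that its first nonzero entry is positive (unique by the linear independence hypothesis). The Minkowski chain $B_1,B_2,\dots$ is the sequence of distinct matrices among $A_1,A_2,A_3,\dots$ in order of appearance ($B_1=A_1$). An $\ell\times\ell$ matrix $B=(b_{i,j})$ acts on $x=(x_1,\dots,x_n)$ by $$B(x)=\Big(\tfrac{\sum_{j=1}^n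 b_{i,j}x_j+b_{i,\ell}}{\sum_{j=1}^n b_{\ell,j}x_j+b_{\ell,\ell}}\Big)_{i=1,\dots,n}.$$ *)

(* Defs.v *)
From Stdlib Require Export Reals QArith Qreals ZArith List.
Export ListNotations.
Open Scope R_scope.

Fixpoint rsum (f : nat -> R) (k : nat) : R :=
  match k with O => 0 | S k' => rsum f k' + f k' end.

Fixpoint qsum (f : nat -> Q) (k : nat) : Q :=
  match k with O => 0%Q | S k' => (qsum f k' + f k')%Q end.

Definition powers_Q_indep (alpha : R) (n : nat) : Prop :=
  forall c : nat -> Q,
    rsum (fun i => Q2R (c i) * alpha ^ i) (S n) = 0 ->
    forall i, (i <= n)%nat -> (c i == 0)%Q.

Definition root_of_Qpoly_deg_le (alpha : R) (d : nat) : Prop :=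
  exists c : nat -> Q,
    (exists i, (i <= d)%nat /\ ~ (c i == 0)%Q) /\
    rsum (fun i => Q2R (c i) * alpha ^ i) (S d) = 0.

Definition algebraic_of_degree (alpha : R) (d : nat) : Prop :=
  root_of_Qpoly_deg_le alpha d /\
  forall e, (e < d)%nat -> ~ root_of_Qpoly_deg_le alpha e.

(* The point x = (x_1,...,x_n) is a list of length n; an integer vector
   r = (r_1,...,r_l), l = n+1, is a list of length l (0-based entries). *)
Definition xi (x : list R) (r : list Z) : R :=
  rsum (fun j => IZR (nth j r 0%Z) * nth j x 0) (length x)
  + IZR (nth (length x) r 0%Z).

Definition supnorm_le (l : nat) (w : list Z) (m : nat) : Prop :=
  forall j, (j < l)%nat -> (Z.abs (nth j w 0%Z) <= Z.of_nat m)%Z.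

Definition Q_lin_indep (l : nat) (ws : list (list Z)) : Prop :=
  forall c : nat -> Q,
    (forall j, (j < l)%nat ->
       (qsum (fun k => c k * inject_Z (nth j (nth k ws []) 0%Z)) (length ws)
        == 0)%Q) ->
    forall k, (k < length ws)%nat -> (c k == 0)%Q.

Definition first_nonzero_pos (l : nat) (w : list Z) : Prop :=
  exists j, (j < l)%nat /\ (forall j', (j' < j)%nat -> nth j' w 0%Z = 0%Z)
            /\ (0 < nth j w 0%Z)%Z.

Definition candidate (l m : nat) (W : list (list Z)) (w : list Z) : Prop :=
  length w = l /\ supnorm_le l w m /\ Q_lin_indep l (W ++ [w]).

Definition is_A (x : list R) (m : nat) (M : list (list Z)) : Prop :=
  let l := S (length x) in
  length M = l /\
  forall i, (i < l)%nat ->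
    let W := firstn i M in
    let w := nth i M [] in
    candidate l m W w /\ first_nonzero_pos l w /\
    forall v, candidate l m W v -> Rabs (xi x w) <= Rabs (xi x v).

(* B is the Minkowski chain of A (A m meaningful for m >= 1):
   B 0, B 1, ... (= B_1, B_2, ...) are the distinct matrices among
   A 1, A 2, ... in order of appearance; B k = A (idx k). *)
Definition is_minkowski_chain (A B : nat -> list (list Z)) : Prop :=
  exists idx : nat -> nat,
    idx 0%nat = 1%nat /\
    (forall k, B k = A (idx k)) /\
    (forall k,
       (idx k < idx (S k))%nat /\
       (forall j, (j <= k)%nat -> A (idx (S k)) <> A (idx j)) /\
       (forall m, (idx k < m < idx (S k))%nat ->
          exists j, (j <= k)%nat /\ A m = A (idx j))).

Definition act (M : list (list Z)) (x : list R) : list R :=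
  map (fun i => xi x (nth i M []) / xi x (nth (length x) M []))
      (seq 0 (length x)).

Definition powvec (n : nat) (alpha : R) : list R :=
  map (fun i => alpha ^ (n - i)) (seq 0 n).

(* Main.v *)
Require Import Defs.
From Stdlib Require Import Classical.
From mathcomp Require all_boot all_order all_algebra perm.
From mathcomp Require ssrZ zify ring lra Rstruct.

(** Write xi(w) for the value at w of the form with coefficients
    alpha^n, ..., alpha, 1, and V for the Q-span of these powers.

    If two matrices of the chain act equally, say B' X = lambda B X for the
    column X of powers, then V is stable under multiplication by lambda, which
    lies in V.  Either lambda is rational, and the minimality and sign of the
    first rows force B = B'; or lambda is a polynomial in alpha of degree
    e with 1 <= e <= n, and lambda alpha^(n+1-e) in V is an equation of degree
    n + 1 for alpha.

    Conversely, let alpha have degree n + 1, so that V is a field.  If w is a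
    Dirichlet approximation, |xi(w)| << m^-n, the products of xi(w) with
    alpha^n, ..., 1 come from n + 1 independent integer vectors of size << m,
    so all the rows w_i of A_m satisfy |xi(w_i)| << m^-n.  The norm
    of an element xi(w) of V is then bounded when |w| << m and
    |xi(w)| << m^-n.  Hence the norms of t xi(w_k) - xi(w_i),
    t = 0, ..., n + 1, are bounded integers up to a fixed denominator; they
    determine a polynomial in t of degree at most n + 1 having
    xi(w_i) / xi(w_k) as a root, so that only finitely many quotients occur. *)

(* The module confines the MathComp notations, which would otherwise change the
   meaning of the statement of the theorem. *)
Module MinkowskiChain.
Import all_boot all_order all_algebra perm ssrZ zify ring lra Rstruct.
Set Implicit Arguments. Unset Strict Implicit. Unset Printing Implicit Defensive.
Import Order.TTheory GRing.Theory Num.Theory.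
Local Open Scope ring_scope.

(** * Polynomials and determinants *)

Lemma poly_roots_seq (F : fieldType) (p : {poly F}) :
  p != 0 -> exists s : seq F, forall x, root p x -> x \in s.
Proof.
elim: {p}_.+1 {-2}p (ltnSn (size p)) => // k IHk p lpk p0.
have [[x rx]|nor] := classic (exists x, root p x); last first.
  by exists [::] => x rx; case: nor; exists x.
have /factor_theorem[q Dp] := rx.
have q0 : q != 0 by apply: contraNneq p0 => q0; rewrite Dp q0 mul0r.
have [|s Hs] := IHk q _ q0.
  by move: lpk; rewrite Dp size_Mmonic ?monicXsubC // size_XsubC addn2.
exists (x :: s) => y; rewrite Dp rootM root_XsubC inE.
by case/orP=> [/Hs ->|->]; rewrite ?orbT.
Qed.

Lemma finite_union (T : eqType) (U : eqType) (vs : seq T) (P : T -> U -> Prop) :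
  (forall v, v \in vs -> exists s : seq U, forall x, P v x -> x \in s) ->
  exists s : seq U, forall v x, v \in vs -> P v x -> x \in s.
Proof.
elim: vs => [|v vs IH] H; first by exists [::].
have [|s Hs] := IH; first by move=> w wvs; apply: H; rewrite inE wvs orbT.
have [|s' Hs'] := H v; first by rewrite inE eqxx.
exists (s' ++ s) => w x; rewrite inE mem_cat => /orP[/eqP-> /Hs' -> //|wvs Px].
by rewrite (Hs w) ?orbT.
Qed.

(* A polynomial of degree at most [d] is determined by its values at [0, ..., d]. *)
Lemma bounded_int_values_roots (R : numFieldType) (d : nat) (K : nat) :
  exists s : seq R, forall F : {poly R}, F != 0 -> (size F <= d.+1)%N ->
    (forall t : 'I_d.+1, exists2 z : int, F.[t%:R] = z%:~R & (`|z| <= K)%N) ->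
    forall x, root F x -> x \in s.
Proof.
(* An entry [a] of a value vector encodes the integer [a - K], so [T] covers all vectors of [d + 1]
   integers of absolute value at most [K]. *)
pose T := {ffun 'I_d.+1 -> 'I_(K + K).+1}.
pose Q (v : T) (F : {poly R}) := [/\ F != 0, (size F <= d.+1)%N &
  forall t : 'I_d.+1, F.[t%:R] = (v t)%:R - K%:R].
have [|s Hs] := @finite_union T R (enum T)
    (fun v x => exists2 F, Q v F & root F x).
  move=> v _; have [[F QF]|noF] := classic (exists F, Q v F); last first.
    by exists [::] => x [F QF _]; case: noF; exists F.
  have [F0 sF vF] := QF; have [s Hs] := poly_roots_seq F0.
  exists s => x [G [G0 sG vG]] rG; apply: Hs.
  suff -> : F = G by [].
  apply/eqP; rewrite -subr_eq0; apply/negPn/negP => FG0.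
  (* [F - G] has degree at most [d] and vanishes at the [d + 1] points 0, ..., [d]; so each value
     vector belongs to at most one polynomial. *)
  pose rs := [seq (val t)%:R : R | t <- enum 'I_d.+1].
  have : (size rs < size (F - G)%R)%N.
    apply: max_poly_roots => //.
      by apply/allP => _ /mapP[t _ ->]; rewrite /root hornerD hornerN vF vG subrr.
    rewrite map_inj_uniq ?enum_uniq // => i j /eqP.
    by rewrite eqr_nat => /eqP /val_inj.
  rewrite size_map size_enum_ord ltnNge (leq_trans (size_polyD _ _)) //.
  by rewrite size_polyN geq_max sF sG.
exists s => F F0 sF vF x rx.
have /fin_all_exists[f Hf] : forall t : 'I_d.+1, exists v : 'I_(K + K).+1,
    F.[t%:R] = v%:R - K%:R.
  move=> t; have [z -> zK] := vF t.
  have lt : (`|(z + K%:Z)%R| < (K + K).+1)%N by lia.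
  exists (Ordinal lt) => /=.
  rewrite natr_absz ger0_norm; last by lia.
  by rewrite intrD addrK.
apply: (Hs [ffun t => f t]) => //; first by rewrite mem_enum.
by exists F => //; split=> // t; rewrite Hf ffunE.
Qed.

Lemma norm_det_le (R : numDomainType) n (A : 'M[R]_n) (E : R) :
  (forall i j, `|A i j| <= E) -> `|\det A| <= n`!%:R * E ^+ n.
Proof.
move=> AE; rewrite /determinant (le_trans (ler_norm_sum _ _ _)) //.
have -> : n`!%:R * E ^+ n = \sum_(s : 'S_n) E ^+ n.
  by rewrite sumr_const mulr_natl -card_Sn.
apply: ler_sum => s _; rewrite normrMsign normr_prod.
rewrite -[n in E ^+ n]card_ord -prodr_const.
by apply: ler_prod => i _; rewrite normr_ge0 AE.
Qed.

(** * Dirichlet's theorem for one linear form *)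

Section LinearForm.
Variables (R : archiRealFieldType) (n : nat) (X : 'cV[R]_n.+1).

Definition linform (w : 'rV[int]_n.+1) : R := (map_mx intr w *m X) 0 0.

Lemma linformE w : linform w = \sum_j (w 0 j)%:~R * X j 0.
Proof. by rewrite /linform mxE; apply: eq_bigr => j _; rewrite mxE. Qed.

Lemma linformB u v : linform (u - v) = linform u - linform v.
Proof. by rewrite /linform map_mxB mulmxBl !mxE. Qed.

(** The summand 1 keeps [S] positive and makes the bound of the form by [S * N] strict for positive
    [N]. *)
Let S : R := 1 + \sum_j `|X j 0|.

Lemma linform_le (w : 'rV[int]_n.+1) (N : nat) :
  (forall j, (`|(w 0 j)%R| <= N)%N) -> `|linform w| <= (S - 1) * N%:R.
Proof.
move=> wN; rewrite linformE (le_trans (ler_norm_sum _ _ _)) //.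
rewrite /S addrAC subrr add0r mulr_suml; apply: ler_sum => j _.
rewrite normrM mulrC ler_wpM2l //.
by rewrite -intr_norm -natr_absz ler_nat.
Qed.

(** Pigeonhole: the [(N + 1)^(n + 1)] vectors with entries in [0, N] outnumber the [N^(n + 1)] equal
    intervals that cover the values of the form. Two vectors in one interval are subtracted. *)
Lemma dirichlet (N : nat) : (0 < N)%N ->
  exists w : 'rV[int]_n.+1, [/\ w != 0, forall j, (`|(w 0 j)%R| <= N)%N &
    `|linform w| * N%:R ^+ n <= 2 * S].
Proof.
move=> N0.
have S0 : 0 < S by rewrite ltr_wpDr ?sumr_ge0.
pose vec (f : {ffun 'I_n.+1 -> 'I_N.+1}) : 'rV[int]_n.+1 := \row_j (f j : nat)%:Z.
(* This rescaling carries the interval from [- S N] to [S N] onto the one from 0 to [N^(n + 1)], so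
   that the pigeonholes become unit intervals, told apart by [truncn]. *)
pose y f : R := (linform (vec f) + S * N%:R) * N%:R ^+ n / (2 * S).
have yb f : 0 <= y f /\ y f < (N ^ n.+1)%:R.
  have : `|linform (vec f)| < S * N%:R.
    have /le_lt_trans-> // : `|linform (vec f)| <= (S - 1) * N%:R.
      by apply: linform_le => j; rewrite mxE -ltnS ltn_ord.
    by rewrite ltr_pM2r ?ltr0n // gtrBl.
  rewrite ltr_norml => /andP[lo hi]; split.
    by rewrite divr_ge0 ?mulr_ge0 ?exprn_ge0 ?ler0n ?(ltW S0) //; lra.
  rewrite ltr_pdivrMr ?mulr_gt0 // natrX exprS mulrAC ltr_pM2r ?exprn_gt0 ?ltr0n //.
  lra.
have lt f : (Num.truncn (y f) < N ^ n.+1)%N.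
  by rewrite truncn_lt_nat; case: (yb f).
have /injectivePn[f [g fg /(congr1 val)/= Efg]] :
    ~~ injectiveb (fun f => Ordinal (lt f)).
  apply/negP => /injectiveP /leq_card.
  by rewrite card_ord card_ffun !card_ord leq_exp2r ?ltnn.
exists (vec f - vec g); split.
- rewrite subr_eq0; apply: contra fg => /eqP/rowP Efg'.
  by apply/eqP/ffunP => j; apply: val_inj; have := Efg' j; rewrite !mxE => -[].
- by move=> j; rewrite !mxE; case: (f j) (g j) => [a lta] [b ltb] /=; lia.
have := truncn_itv (yb f).1; have := truncn_itv (yb g).1; rewrite Efg => bg bf.
have /ltW : `|y f - y g| < 1.
  by move: bg bf; rewrite -natr1 ltr_norml; lra.
have -> : y f - y g = linform (vec f - vec g) * N%:R ^+ n / (2 * S).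
  by rewrite linformB /y; field; rewrite gt_eqF.
rewrite normrM normfV (gtr0_norm (mulr_gt0 _ S0)) // ler_pdivrMr ?mulr_gt0 // mul1r.
by rewrite normrM (ger0_norm (exprn_ge0 _ (ler0n _ _))).
Qed.

End LinearForm.

Lemma size_det_poly_le (R : comNzRingType) k (A : 'M[{poly R}]_k) :
  (forall i j, (size (A i j) <= 2)%N) -> (size (\det A) <= k.+1)%N.
Proof.
move=> sA; rewrite /determinant (leq_trans (size_sum _ _ _)) //.
apply/bigmax_leqP => s _; rewrite size_Msign.
rewrite (leq_trans (size_poly_prod_leq _ _)) // leq_subLR.
rewrite [X in (_ <= X + _)%N]card_ord addnS ltnS addnn -muln2.
by rewrite -[k in (k * 2)%N]card_ord -sum_nat_const leq_sum.
Qed.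

(** * Minimal systems when the span of the coefficients is a field *)

Section FieldStructure.
Variables (R : archiRealFieldType) (n : nat) (X : 'cV[R]_n.+1).
Hypothesis indepX : forall w : 'rV[int]_n.+1, linform X w = 0 -> w = 0.
(** Integral form of the closure of the Q-span of [X] under multiplication: the [G j] hold its
    structure constants, cleared of the common denominator [D]. *)
Variables (D : nat) (G : 'I_n.+1 -> 'M[int]_n.+1).
Hypothesis D_gt0 : (0 < D)%N.
Hypothesis GX : forall j, map_mx intr (G j) *m X = (D%:R * X j 0) *: X.

Local Notation lin := (linform X).
Let S : R := 1 + \sum_j `|X j 0|.

Let S_gt0 : 0 < S. Proof. by rewrite ltr_wpDr ?sumr_ge0. Qed.

Let X_le j : `|X j 0| <= S.
Proof. by rewrite /S (bigD1 j) //= addrCA lerDl addr_ge0 ?sumr_ge0. Qed.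

Let D_neq0 : D%:R != 0 :> R. Proof. by rewrite pnatr_eq0 -lt0n. Qed.

Let X0_neq0 : X 0 0 != 0.
Proof.
apply/eqP => X0; have /rowP/(_ 0) : delta_mx 0 0 = 0 :> 'rV[int]_n.+1.
  by apply: indepX; rewrite /linform map_delta_mx -rowE mxE.
by rewrite !mxE.
Qed.

(** One crude constant for all sums of structure constants below; the successor makes it a
    legitimate divisor. *)
Let E : nat := (\sum_j \sum_i \sum_k `|(G j i k)%R|).+1.

Let col_le j k : (\sum_i `|(G j i k)%R| <= E)%N.
Proof.
apply: leqW; rewrite [X in (_ <= X)%N](bigD1 j) //=.
apply: leq_trans (leq_addr _ _).
by apply: leq_sum => i _; rewrite (bigD1 k) //= leq_addr.
Qed.

Let entry_le i k : (\sum_j `|(G j i k)%R| <= E)%N.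
Proof.
apply: leqW; apply: leq_sum => j _.
by rewrite (bigD1 i) //= (bigD1 k) //= -addnA leq_addr.
Qed.

Let absz_sum_le (u v : 'I_n.+1 -> int) (N : nat) :
  (forall j, (`|u j| <= N)%N) -> (\sum_j `|v j| <= E)%N ->
  (`|(\sum_j u j * v j)%R| <= N * E)%N.
Proof.
move=> uN vE; rewrite -lez_nat abszE (le_trans (ler_norm_sum _ _ _)) //.
apply: (@le_trans _ _ (\sum_j N%:Z * `|v j|)).
  by apply: ler_sum => j _; rewrite normrM ler_wpM2r // -abszE lez_nat.
rewrite -mulr_sumr PoszM ler_wpM2l // -[X in X <= _]/(_ : int).
rewrite (eq_bigr (fun j => (`|v j|%N)%:Z)) => [|j _]; last by rewrite abszE.
by rewrite -(big_morph Posz PoszD (erefl 0%:Z)) lez_nat.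
Qed.

Definition mulmat (w : 'rV[int]_n.+1) : 'M[int]_n.+1 := \sum_j w 0 j *: G j.

Lemma mulmatE w i k : mulmat w i k = \sum_j w 0 j * G j i k.
Proof. by rewrite summxE; apply: eq_bigr => j _; rewrite mxE. Qed.

Lemma mulmatBZ (t : int) (u v : 'rV[int]_n.+1) :
  mulmat (t *: u - v) = t *: mulmat u - mulmat v.
Proof.
apply/matrixP => i k; rewrite !(mxE, mulmatE) mulr_sumr -sumrB.
by apply: eq_bigr => j _; rewrite !mxE; ring.
Qed.

Lemma mulmatX w : map_mx intr (mulmat w) *m X = (D%:R * lin w) *: X.
Proof.
apply/colP => i; rewrite !mxE linformE mulr_sumr mulr_suml.
under eq_bigr do rewrite mxE mulmatE rmorph_sum mulr_suml.
rewrite exchange_big; apply: eq_bigr => j _ /=.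
have /colP/(_ i) := GX j; rewrite !mxE => GXj.
transitivity ((w 0 j)%:~R * (D%:R * X j 0 * X i 0)); last by ring.
rewrite -GXj mulr_sumr; apply: eq_bigr => k _.
by rewrite mxE rmorphM mulrA.
Qed.

Lemma mulmat_le (w : 'rV[int]_n.+1) (N : nat) :
  (forall j, (`|(w 0 j)%R| <= N)%N) ->
  forall i k, (`|(mulmat w i k)%R| <= N * E)%N.
Proof. by move=> wN i k; rewrite mulmatE; apply: absz_sum_le. Qed.

Let lin0 : lin 0 = 0. Proof. by rewrite -(subrr 0) linformB subrr. Qed.

Let lin_prod_neq0 v w : v != 0 -> w != 0 -> D%:R * lin w * lin v != 0.
Proof.
move=> v0 w0; rewrite !mulf_neq0 //.
  by apply: contraNneq w0 => /indepX ->.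
by apply: contraNneq v0 => /indepX ->.
Qed.

(** A vector [v] in the left kernel would satisfy [D * lin w * lin v = 0], against the independence
    of the entries of [X]. *)
Lemma det_mulmat_neq0 w : w != 0 -> \det (mulmat w) != 0.
Proof.
move=> w0; apply/det0P => -[v v0 /(congr1 lin)/eqP].
have -> : lin (v *m mulmat w) = D%:R * lin w * lin v.
  by rewrite /linform map_mxM -mulmxA mulmatX -scalemxAr mxE.
by rewrite lin0; apply/negP/lin_prod_neq0.
Qed.

(** Row [j] is the integer vector that represents [D * X_j * lin w]: one small value of the form
    yields [n + 1] independent ones. *)
Definition multiples (w : 'rV[int]_n.+1) : 'M[int]_n.+1 := \matrix_j (w *m G j).

Lemma linform_multiples w j : lin (row j (multiples w)) = D%:R * X j 0 * lin w.
Proof.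
by rewrite rowK /linform map_mxM -mulmxA GX -scalemxAr mxE.
Qed.

Lemma det_multiples_neq0 w : w != 0 -> \det (multiples w) != 0.
Proof.
move=> w0; apply/det0P => -[v v0 /(congr1 lin)].
have -> : lin (v *m multiples w) = D%:R * lin w * lin v.
  rewrite mulmx_sum_row {1}/linform raddf_sum /= mulmx_suml summxE.
  rewrite (linformE X v) mulr_sumr; apply: eq_bigr => j _.
  rewrite map_mxZ -scalemxAl mxE -/(lin _) linform_multiples /=; ring.
by rewrite lin0 => /eqP; apply/negP/lin_prod_neq0.
Qed.

Lemma multiples_le (w : 'rV[int]_n.+1) (N : nat) :
  (forall j, (`|(w 0 j)%R| <= N)%N) ->
  forall i k, (`|(multiples w i k)%R| <= N * E)%N.
Proof. by move=> wN i k; rewrite !mxE; apply: absz_sum_le. Qed.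

(** The trace that the successive choice of rows leaves: for each [i], some row of a nonsingular [V]
    was a competitor for row [i]. *)
Definition minimal_system (m : nat) (W : 'M[int]_n.+1) :=
  [/\ forall i, row i W != 0, forall i j, (`|(W i j)%R| <= m)%N &
    forall V : 'M[int]_n.+1, \det V != 0 -> (forall i j, (`|(V i j)%R| <= m)%N) ->
    forall i, exists j, `|lin (row i W)| <= `|lin (row j V)|].

(** Dirichlet's theorem bounds one value [lin w]; the nonsingular competitor [multiples w] spreads
    the bound to every row. *)
Lemma minimal_system_le : exists C : R, forall m W, (0 < m)%N ->
  minimal_system m W -> forall i, `|lin (row i W)| * m%:R ^+ n <= C.
Proof.
(* [C1] serves the case [m < E], where the quotient [m %/ E] is 0 and Dirichlet's theorem does not
   apply; [C2] serves [E <= m]. *)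
pose C1 : R := S * E%:R ^+ n.+1.
pose C2 : R := D%:R * S * (2 * S) * (2 * E%:R) ^+ n.
have C1_ge0 : 0 <= C1 by rewrite mulr_ge0 ?exprn_ge0 ?ltW.
have C2_ge0 : 0 <= C2 by rewrite !mulr_ge0 ?exprn_ge0 ?mulr_ge0 ?(ltW S_gt0).
exists (C1 + C2) => m W m0 [W0 Wm Wmin] i.
have [mE|Em] := ltnP m E.
  apply: (@le_trans _ _ C1); last by rewrite lerDl.
  have mE' : (m%:R : R) <= E%:R by rewrite ler_nat ltnW.
  apply: (@le_trans _ _ (S * m%:R * m%:R ^+ n)).
    rewrite ler_wpM2r ?exprn_ge0 //.
    have /le_trans-> // : `|lin (row i W)| <= (S - 1) * m%:R.
      by apply: linform_le => j; rewrite mxE.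
    by rewrite ler_wpM2r // gerBl.
  by rewrite -mulrA -exprS ler_pM2l // lerXn2r ?nnegrE.
apply: (@le_trans _ _ C2); last by rewrite lerDr.
have E0 : (0 < E)%N by [].
(* Passing to [multiples w] enlarges entries by a factor of at most [E], so they stay within [m]. *)
set N := (m %/ E)%N.
have N0 : (0 < N)%N by rewrite divn_gt0.
have [w [w0 wN wlin]] := dirichlet X N0.
have NE : (N * E <= m)%N by rewrite leq_divM.
have [] := Wmin _ (det_multiples_neq0 w0) _ i.
  by move=> k j; rewrite (leq_trans (multiples_le wN _ _)).
move=> j; rewrite linform_multiples => le.
(* Rounding down costs at most a factor 2, since [m < (N + 1) * E] and [1 <= N]. *)
have mN : (m%:R : R) <= 2 * E%:R * N%:R.
  rewrite -!natrM ler_nat; have := ltn_ceil m E0; rewrite -/N; nia.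
apply: (@le_trans _ _ (D%:R * S * `|lin w| * (2 * E%:R * N%:R) ^+ n)).
  apply: ler_pM; rewrite ?exprn_ge0 //; last by rewrite lerXn2r ?nnegrE ?mulr_ge0.
  rewrite (le_trans le) // !normrM normr_nat ler_wpM2r // ler_wpM2l //.
rewrite /C2 exprMn mulrCA mulrA [X in X <= _]mulrC.
rewrite [X in X <= _](_ : _ =
  D%:R * S * (`|lin w| * N%:R ^+ n) * (2 * E%:R) ^+ n); last by ring.
by rewrite ler_wpM2r ?exprn_ge0 ?mulr_ge0 // ler_wpM2l // mulr_ge0 // ltW.
Qed.

(* [X] is an eigenvector of [mulmat w] for the small eigenvalue [D * lin w];
   the remaining factor of the determinant is an [n]-th order minor. *)
Lemma det_mulmat_le (a : nat) (b : R) : exists K : nat, forall (m : nat)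
    (w : 'rV[int]_n.+1),
  (forall j, (`|(w 0 j)%R| <= a * m)%N) -> `|lin w| * m%:R ^+ n <= b ->
  (`|(\det (mulmat w))%R| <= K)%N.
Proof.
pose C : R := D%:R * S * n`!%:R * (a%:R * E%:R) ^+ n.
have C0 : 0 <= C by rewrite !mulr_ge0 ?exprn_ge0 ?mulr_ge0 ?(ltW S_gt0).
exists (Num.truncn (C * b / `|X 0 0|)) => m w wm wb.
have b0 : 0 <= b by apply: le_trans wb; rewrite mulr_ge0 ?exprn_ge0.
rewrite truncn_ge_nat ?(divr_ge0 (mulr_ge0 C0 b0)) //.
rewrite ler_pdivlMr ?normr_gt0 // natr_absz intr_norm -normrM.
(* Apply [\adj A *m A = (\det A)%:M] to the eigenvector [X] and read off entry 0. The entries of the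
   adjugate are of order [m^n], which [lin w] compensates. *)
have -> : (\det (mulmat w))%:~R * X 0 0 =
    D%:R * lin w * (\adj (map_mx intr (mulmat w)) *m X) 0 0.
  set A := map_mx _ _.
  have /colP/(_ 0) : (\det A)%:M *m X = (D%:R * lin w) *: (\adj A *m X).
    by rewrite -mul_adj_mx -mulmxA mulmatX -scalemxAr.
  by rewrite mul_scalar_mx det_map_mx [LHS]mxE [RHS]mxE.
rewrite !normrM normr_nat mxE.
have adj_le j : `|\adj (map_mx intr (mulmat w)) 0 j| <=
    n`!%:R * (a%:R * m%:R * E%:R) ^+ n :> R.
  rewrite mxE /cofactor normrMsign; apply: norm_det_le => i k.
  rewrite !mxE -intr_norm -natr_absz -!natrM ler_nat.
  exact: mulmat_le.
apply: (@le_trans _ _ (D%:R * `|lin w| *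
    (n`!%:R * (a%:R * m%:R * E%:R) ^+ n * S))).
  apply: ler_wpM2l; first by rewrite mulr_ge0.
  rewrite (le_trans (ler_norm_sum _ _ _)) // /S mulrDr mulr1 ler_wpDl //.
    by rewrite mulr_ge0 ?exprn_ge0 ?mulr_ge0.
  by rewrite mulr_sumr ler_sum // => j _; rewrite normrM ler_wpM2r.
rewrite [X in X <= _](_ : _ = C * (`|lin w| * m%:R ^+ n)).
  by rewrite ler_wpM2l.
by rewrite /C !exprMn; ring.
Qed.

(* For rows [u], [v] the polynomial [det (t M_u - M_v)] is, up to a constant
   factor, the norm of [t * lin u - lin v]. *)
Lemma minimal_system_ratios : exists s : seq R, forall m W, (0 < m)%N ->
  minimal_system m W ->
  forall i k, lin (row i W) / lin (row k W) \in s.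
Proof.
have [C HC] := minimal_system_le.
(* As [t <= n + 1], the vector [t u - v] has entries at most [(n + 2) m], and its form times [m^n]
   is at most [(n + 2) C]. *)
have [K HK] := det_mulmat_le n.+2 (n.+2%:R * C).
have [s Hs] := bounded_int_values_roots R n.+1 K.
exists s => m W m0 minW i k; have [W0 Wm _] := minW.
set u := row k W; set v := row i W.
have lu0 : lin u != 0 by apply: contraNneq (W0 k) => /indepX/eqP.
pose PM (w : 'rV[int]_n.+1) := map_mx polyC (map_mx (intr : int -> R) (mulmat w)).
pose F : {poly R} := \det ('X *: PM u - PM v).
have FE x : F.[x] = \det (x *: map_mx intr (mulmat u) - map_mx intr (mulmat v)).
  rewrite /F -horner_evalE -det_map_mx; congr (\det _); apply/matrixP => p q.
  by rewrite !mxE /= horner_evalE !hornerE.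
have FZ (t : nat) : F.[t%:R] = (\det (mulmat (t%:Z *: u - v)))%:~R.
  by rewrite FE -det_map_mx mulmatBZ map_mxB map_mxZ.
apply: (Hs F).
(* The value of [F] at 0 is the determinant of [mulmat (- v)], nonzero because [v] is. *)
- apply/eqP => F0; have := FZ 0%N; rewrite F0 horner0 => /esym/eqP.
  rewrite intr_eq0; apply/negP; apply: det_mulmat_neq0.
  by rewrite scale0r sub0r oppr_eq0 W0.
- apply: size_det_poly_le => p q; rewrite !mxE.
  rewrite (leq_trans (size_polyD _ _)) // geq_max size_polyN.
  rewrite (leq_trans (size_polyMleq _ _)) ?size_polyX !size_polyC; first by case: eqP.
  by case: eqP.
- move=> t; exists (\det (mulmat (t%:Z *: u - v))); first exact: FZ.
  have tn : (t <= n.+1)%N by rewrite -ltnS.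
  apply: (HK m) => [j|].
    have := Wm i j; have := Wm k j; rewrite !mxE; nia.
  have -> : lin (t%:Z *: u - v) = t%:R * lin u - lin v.
    by rewrite linformB /linform map_mxZ -scalemxAl mxE.
  apply: (@le_trans _ _ ((t%:R * `|lin u| + `|lin v|) * m%:R ^+ n)).
    rewrite ler_wpM2r ?exprn_ge0 // (le_trans (ler_normB _ _)) //.
    by rewrite normrM normr_nat.
  rewrite mulrDl -mulrA -natr1 mulrDl mul1r lerD ?HC //.
  apply: ler_pM => //; rewrite ?mulr_ge0 ?exprn_ge0 ?ler_nat //.
  exact: HC.
- rewrite /root FE.
  set A := (A in \det A).
  (* At the quotient [lin v / lin u] the two eigenvalues cancel, and the nonzero column [X] makes
     [A] singular. *)
  have AX : A *m X = 0.
    rewrite mulmxBl -scalemxAl !mulmatX scalerA -scalerBl.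
    by rewrite mulrCA divfK // subrr scale0r.
  have /(congr1 (mulmx (\adj A))) := AX.
  rewrite mulmxA mul_adj_mx mul_scalar_mx mulmx0 => /colP/(_ 0).
  by rewrite !mxE => /eqP; rewrite mulf_eq0 (negPf X0_neq0) orbF.
Qed.

End FieldStructure.

(** * Rational numbers and powers of alpha *)

Local Notation RR := Rdefinitions.R.

Lemma rsumE (f : nat -> RR) k : rsum f k = \sum_(i < k) f i.
Proof. by elim: k => [|k IH] /=; rewrite ?big_ord0 // big_ord_recr /= -IH. Qed.

Lemma IZR_int z : IZR z = (int_of_Z z)%:~R :> RR.
Proof.
have posE p : IZR (Z.pos p) = (Pos.to_nat p)%:R :> RR.
  by rewrite -INRE INR_IZR_INZ positive_nat_Z.
case: z => [//|p|p]; first by rewrite posE.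
rewrite IZR_NEG posE [int_of_Z _]/= NegzE.
have p0 : (0 < Pos.to_nat p)%N by apply/ssrnat.ltP/Pos2Nat.is_pos.
by rewrite (prednK p0) mulrNz.
Qed.

Definition rat_of_Q (q : Q) : rat :=
  (int_of_Z (Qnum q))%:~R / (int_of_Z (Zpos (Qden q)))%:~R.

Definition Q_of_rat (r : rat) : Q :=
  Qmake (Z_of_int (numq r)) (Z.to_pos (Z_of_int (denq r))).

Lemma ratr_rat_of_Q q : ratr (rat_of_Q q) = Q2R q :> RR.
Proof.
by rewrite /rat_of_Q fmorph_div /= !ratr_int /Q2R RmultE RinvE !IZR_int.
Qed.

Lemma Q_of_ratK : cancel Q_of_rat rat_of_Q.
Proof.
move=> r; rewrite /rat_of_Q /Q_of_rat [Qnum _]/= [Qden _]/=.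
have := denq_gt0 r => dr.
rewrite Z2Pos.id; last by lia.
by rewrite !Z_of_intK divq_num_den.
Qed.

Lemma Q2R_eq0 q : Q2R q = 0 <-> Qeq q 0.
Proof.
have Q2R0 : Q2R 0 = 0 by rewrite /Q2R /= RmultE mul0r.
by split=> [H|/Qeq_eqR ->//]; apply: eqR_Qeq; rewrite H Q2R0.
Qed.

Lemma rat_of_Q_eq0 q : rat_of_Q q = 0 <-> Qeq q 0.
Proof.
rewrite -Q2R_eq0 -ratr_rat_of_Q; split=> [->|/eqP]; first by rewrite rmorph0.
by rewrite fmorph_eq0 => /eqP.
Qed.

Lemma Q2R_qsum f k : Q2R (qsum f k) = \sum_(i < k) Q2R (f i).
Proof.
elim: k => [|k IH] /=; last by rewrite big_ord_recr /= -IH Q2R_plus.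
by rewrite big_ord0; apply/Q2R_eq0.
Qed.

Definition ratroot (alpha : RR) (p : {poly rat}) := (map_poly ratr p).[alpha] == 0.

Lemma horner_map_poly_def (alpha : RR) k (c : nat -> rat) :
  (map_poly ratr (\poly_(i < k) c i)).[alpha] = \sum_(i < k) ratr (c i) * alpha ^+ i.
Proof.
rewrite poly_def rmorph_sum horner_sum; apply: eq_bigr => i _ /=.
by rewrite map_polyZ map_polyXn hornerZ hornerXn.
Qed.

Lemma rsum_powers (alpha : RR) k (c : nat -> Q) :
  rsum (fun i => Rmult (Q2R (c i)) (pow alpha i)) k =
  (map_poly ratr (\poly_(i < k) rat_of_Q (c i))).[alpha].
Proof.
rewrite rsumE horner_map_poly_def; apply: eq_bigr => i _.
by rewrite ratr_rat_of_Q RpowE.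
Qed.

Lemma poly_of_size (p : {poly rat}) k : (size p <= k)%N ->
  p = \poly_(i < k) rat_of_Q (Q_of_rat p`_i).
Proof.
move=> sp; apply/polyP => i; rewrite coef_poly Q_of_ratK.
by case: ltnP => // ki; rewrite nth_default // (leq_trans sp).
Qed.

Lemma powers_Q_indepP alpha n : powers_Q_indep alpha n ->
  forall p : {poly rat}, (size p <= n.+1)%N -> ratroot alpha p -> p = 0.
Proof.
move=> H p sp; rewrite /ratroot {1}(poly_of_size sp) -rsum_powers => /eqP /H{}H.
apply/polyP => i; rewrite coef0; case: (leqP (size p) i) => [/(nth_default _)//|ip].
by rewrite -(Q_of_ratK p`_i); apply/rat_of_Q_eq0/H/ssrnat.leP; rewrite -ltnS (leq_trans ip).
Qed.

Lemma root_of_Qpoly_deg_leP alpha d : root_of_Qpoly_deg_le alpha d <->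
  exists p : {poly rat}, [/\ p != 0, (size p <= d.+1)%N & ratroot alpha p].
Proof.
split=> [[c [[i [/ssrnat.leP lid ci]]]]|[p [p0 sp]]].
  rewrite rsum_powers => /eqP rc; exists (\poly_(i < d.+1) rat_of_Q (c i)).
  split; [|exact: size_poly|exact: rc].
  apply: contra_notN ci => /eqP/polyP/(_ i).
  by rewrite coef_poly ltnS lid coef0 => /rat_of_Q_eq0.
rewrite /ratroot {1}(poly_of_size sp) -rsum_powers => /eqP rp.
exists (fun i => Q_of_rat p`_i); split=> //.
exists (size p).-1; split.
  by apply/ssrnat.leP; move: p0 sp; rewrite -size_poly_gt0; case: (size p).
move/rat_of_Q_eq0; rewrite Q_of_ratK => /eqP.
by rewrite lead_coef_eq0 (negPf p0).
Qed.

Lemma common_denominator (T : finType) (f : T -> rat) :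
  exists2 D : nat, (0 < D)%N & exists z : T -> int, forall t, D%:R * f t = (z t)%:~R.
Proof.
have absd (r : rat) : (`|denq r|)%:R = (denq r)%:~R :> rat.
  by rewrite natr_absz ger0_norm ?denq_ge0.
exists (\prod_t `|denq (f t)|)%N.
  by apply: prodn_gt0 => t; rewrite absz_gt0 denq_neq0.
suff: forall t, exists z : int, (\prod_t `|denq (f t)|)%N%:R * f t = z%:~R.
  by case/fin_all_exists => z; exists z.
move=> t; exists ((\prod_(s | s != t) `|denq (f s)|)%N%:Z * numq (f t)).
rewrite (bigD1 t) //= natrM rmorphM /= absd mulrAC -{2}(divq_num_den (f t)).
rewrite mulrC; congr (_ * _).
by rewrite mulrC divfK // intr_eq0 denq_neq0.
Qed.

(** * Linear relations between the powers of alpha *)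

Section Powers.
Variables (alpha : RR) (n : nat).

Definition powcol : 'cV[RR]_n.+1 := \col_j alpha ^+ (n - j).

Definition polyrow (c : 'rV[rat]_n.+1) : {poly rat} := \sum_j c 0 j *: 'X^(n - j).

Lemma polyrow_eval c :
  (map_poly ratr (polyrow c)).[alpha] = (map_mx ratr c *m powcol) 0 0.
Proof.
rewrite rmorph_sum horner_sum mxE; apply: eq_bigr => i _ /=.
by rewrite map_polyZ map_polyXn hornerZ hornerXn !mxE.
Qed.

Lemma size_polyrow c : (size (polyrow c) <= n.+1)%N.
Proof.
rewrite (leq_trans (size_sum _ _ _)) //; apply/bigmax_leqP => i _.
by rewrite (leq_trans (size_scale_leq _ _)) // size_polyXn ltnS leq_subr.
Qed.

Lemma polyrow_coef c (j : 'I_n.+1) : (polyrow c)`_(n - j) = c 0 j.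
Proof.
rewrite coef_sum (bigD1 j) //= coefZ coefXn eqxx mulr1 big1 ?addr0 // => i ij.
rewrite coefZ coefXn; case: eqP => [E|]; last by rewrite mulr0.
case/eqP: ij; apply: val_inj => /=.
by have := ltn_ord i; have := ltn_ord j; move: E; lia.
Qed.

Hypothesis indep : powers_Q_indep alpha n.

Lemma powcol_indep_rat (c : 'rV[rat]_n.+1) : map_mx ratr c *m powcol = 0 -> c = 0.
Proof.
move=> /colP/(_ 0); rewrite -polyrow_eval mxE => /eqP.
move/(powers_Q_indepP indep (size_polyrow c)) => pc0.
by apply/rowP => j; rewrite -polyrow_coef pc0 coef0 mxE.
Qed.

Lemma ratr_intr_mx k l (A : 'M[int]_(k, l)) :
  map_mx ratr (map_mx intr A : 'M[rat]_(k, l)) = map_mx intr A :> 'M[RR]_(k, l).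
Proof. by apply/matrixP => i j; rewrite !mxE ratr_int. Qed.

Lemma powcol_indep_int (w : 'rV[int]_n.+1) : linform powcol w = 0 -> w = 0.
Proof.
move=> w0; have /powcol_indep_rat/rowP cw0 :
    map_mx ratr (map_mx intr w : 'rV[rat]_n.+1) *m powcol = 0.
  by rewrite ratr_intr_mx; apply/colP => i; rewrite ord1 [RHS]mxE.
by apply/rowP => j; have := cw0 j; rewrite !mxE => /eqP; rewrite intr_eq0 => /eqP.
Qed.

(** Products of two powers of alpha are reduced modulo a polynomial [p] that vanishes at alpha; the
    coefficients of the remainders, cleared of denominators, fill the matrices. *)
Lemma powcol_mult_struct : algebraic_of_degree alpha n.+1 ->
  exists2 D : nat, (0 < D)%N & exists G : 'I_n.+1 -> 'M[int]_n.+1,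
    forall j, map_mx intr (G j) *m powcol = (D%:R * powcol j 0) *: powcol.
Proof.
case=> /root_of_Qpoly_deg_leP[p [p0 sp rp]] _.
(* Independence of the powers up to [n] forces [p] to have degree exactly [n + 1], so remainders
   have degree at most [n]. *)
have sp2 : size p = n.+2.
  apply/eqP; rewrite eqn_leq sp ltnNge; apply: contraNN p0 => sp1.
  by rewrite (powers_Q_indepP indep sp1 rp).
pose r (i j : 'I_n.+1) := 'X^(n - i + (n - j)) %% p.
have [D D0 [z Hz]] := common_denominator
  (fun t : 'I_n.+1 * 'I_n.+1 * 'I_n.+1 => (r t.1.1 t.1.2)`_(n - t.2)).
exists D => //; exists (fun j => \matrix_(i, k) z (i, j, k)) => j.
apply/colP => i; rewrite !mxE.
have -> : D%:R * alpha ^+ (n - j) * alpha ^+ (n - i) =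
    D%:R * (map_poly ratr (r i j)).[alpha] :> RR.
  rewrite -mulrA -exprD; congr (_ * _).
  have /(congr1 (fun q => (map_poly ratr q).[alpha])) :=
    divp_eq 'X^(n - i + (n - j)) p.
  rewrite rmorphD rmorphM map_polyXn hornerXn hornerD hornerM (eqP rp) mulr0 add0r.
  by move=> <-; rewrite addnC.
have sr : (size (r i j) <= n.+1)%N by rewrite -ltnS -sp2 ltn_modp.
rewrite [X in map_poly ratr X](_ : _ = \poly_(k < n.+1) (r i j)`_k); last first.
  apply/polyP => k; rewrite coef_poly; case: ltnP => // nk.
  by rewrite nth_default // (leq_trans sr).
(* The entries of [powcol] run through decreasing exponents, hence the reversal of the index. *)
rewrite horner_map_poly_def mulr_sumr [RHS](reindex_inj rev_ord_inj) /=.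
apply: eq_bigr => k _; rewrite subSS !mxE -(ratr_int _ (z _)) -Hz /= rmorphM /= ratr_nat.
by rewrite -mulrA.
Qed.

(* If [lambda = p(alpha)] with [p] of degree [e >= 1], then multiplying
   [alpha ^ (n + 1 - e)] by [lambda] puts a polynomial of degree [n + 1] in
   the span of the lower powers. *)
Lemma proportional_systems (M M' : 'M[rat]_n.+1) (lambda : RR) :
  M' \in unitmx ->
  map_mx ratr M *m powcol = lambda *: (map_mx ratr M' *m powcol) ->
  (exists2 q, lambda = ratr q & M = q *: M') \/ root_of_Qpoly_deg_le alpha n.+1.
Proof.
move=> uM' EM.
(* [N] is the matrix of multiplication by [lambda] on the span of the powers. *)
pose N := invmx M' *m M.
have EN : map_mx ratr N *m powcol = lambda *: powcol.
  rewrite map_mxM -mulmxA EM -scalemxAr mulmxA -map_mxM mulVmx //.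
  by rewrite map_mx1 mul1mx.
have evN j : (map_poly ratr (polyrow (row j N))).[alpha] = lambda * alpha ^+ (n - j).
  rewrite polyrow_eval map_row -row_mul EN mxE mxE mxE //.
(* The last entry of [powcol] is 1, so the last row of [N] writes [lambda] itself as a polynomial in
   alpha. *)
pose p := polyrow (row ord_max N).
have evp : (map_poly ratr p).[alpha] = lambda by rewrite evN subnn mulr1.
have [sp|sp] := leqP (size p) 1.
  left; have [q Eq] : exists q, p = q%:P by exists p`_0; exact: size1_polyC.
  exists q; first by rewrite -evp Eq map_polyC hornerC.
  have lq : lambda = ratr q by rewrite -evp Eq map_polyC hornerC.
  apply/row_matrixP => i; apply/eqP; rewrite -subr_eq0; apply/eqP.
  apply: powcol_indep_rat; rewrite -linearB /= map_row -row_mul.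
  by rewrite map_mxB map_mxZ mulmxBl EM -scalemxAl lq subrr; apply/rowP => ?; rewrite !mxE.
right; apply/root_of_Qpoly_deg_leP.
have spn := size_polyrow (row ord_max N); rewrite -/p in spn.
set e := (size p).-1.
have [e0 en Ee] : [/\ (0 < e)%N, (e <= n)%N & size p = e.+1] by rewrite /e; split; lia.
have ltj : (e.-1 < n.+1)%N by lia.
have p0 : p != 0 by rewrite -size_poly_gt0; lia.
(* Entry [e - 1] of [powcol] is [alpha ^ (n + 1 - e)]; this row of [N] gives its product with
   [lambda] in degree at most [n]. *)
pose pj := polyrow (row (Ordinal ltj) N).
have sP : size (p * 'X^(n.+1 - e) - pj) = n.+2.
  rewrite size_polyDl.
    by rewrite size_mulXn // Ee; lia.
  by rewrite size_polyN size_mulXn // Ee (leq_ltn_trans (size_polyrow _)) //; lia.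
exists (p * 'X^(n.+1 - e) - pj); split; rewrite ?sP // -?size_poly_gt0 ?sP //.
rewrite /ratroot rmorphB rmorphM /= map_polyXn !hornerE evp evN /=.
by rewrite (_ : n - e.-1 = n.+1 - e)%N ?subrr //; lia.
Qed.

End Powers.

(** * Minkowski chains *)

Definition rowZ l (w : list Z) : 'rV[int]_l := \row_j int_of_Z (List.nth j w Z0).

Definition mxZ k l (ws : list (list Z)) : 'M[int]_(k, l) :=
  \matrix_i rowZ l (List.nth i ws [::]).

Definition mxQ k l ws : 'M[rat]_(k, l) := map_mx intr (mxZ k l ws).

Lemma row_mxZ k l ws (i : 'I_k) : row i (mxZ k l ws) = rowZ l (List.nth i ws [::]).
Proof. exact: rowK. Qed.

Lemma qsum_mxQ k l (ws : list (list Z)) (c : nat -> Q) (j : 'I_l) :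
  length ws = k ->
  Qeq (qsum (fun i => Qmult (c i) (inject_Z (List.nth j (List.nth i ws [::]) Z0)))
        (length ws)) 0 <->
  ((\row_(i < k) rat_of_Q (c i)) *m mxQ k l ws) 0 j = 0.
Proof.
move=> ->; rewrite -Q2R_eq0 Q2R_qsum.
set S := \sum_(i < k) _.
have -> : S = ratr (((\row_(i < k) rat_of_Q (c i)) *m mxQ k l ws) 0 j).
  rewrite mxE rmorph_sum; apply: eq_bigr => i _ /=.
  rewrite !mxE rmorphM /= ratr_int ratr_rat_of_Q -IZR_int Q2R_mult.
  by rewrite {2}/Q2R /inject_Z /= Rinv_1 Rmult_1_r.
by split=> [/eqP|->]; rewrite ?rmorph0 // fmorph_eq0 => /eqP.
Qed.

Lemma Q_lin_indepP k l (ws : list (list Z)) : length ws = k ->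
  Q_lin_indep l ws <-> row_free (mxQ k l ws).
Proof.
move=> lk; split=> [H|free c Hc i /ssrnat.ltP ik].
  apply: inj_row_free => v vM.
  pose c i := Q_of_rat (if insub i is Some o then v 0 (o : 'I_k) else 0).
  have cE : (\row_(i < k) rat_of_Q (c i)) = v.
    by apply/rowP => i; rewrite mxE /c valK Q_of_ratK.
  apply/rowP => i; rewrite -cE !mxE; apply/rat_of_Q_eq0/H.
    move=> j /ssrnat.ltP jl; apply/(@qsum_mxQ k l _ _ (Ordinal jl) lk).
    by rewrite cE vM mxE.
  by rewrite lk; apply/ssrnat.ltP.
rewrite lk in ik; apply/rat_of_Q_eq0.
suff /rowP/(_ (Ordinal ik)) : \row_(i < k) rat_of_Q (c i) = 0 by rewrite !mxE.
apply/eqP; rewrite -(mulmx_free_eq0 _ free); apply/eqP/rowP => j.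
by rewrite [RHS]mxE; apply/(qsum_mxQ _ _ lk)/Hc/ssrnat.ltP.
Qed.

Lemma mxQ_rcons k l ws v : length ws = k ->
  mxQ (k + 1) l (List.app ws [:: v]) = col_mx (mxQ k l ws) (map_mx intr (rowZ l v)).
Proof.
move=> lk; apply/matrixP => a b; case: (split_ordP a) => a' ->.
  rewrite col_mxEu !mxE List.app_nth1 // lk. exact: (ssrnat.ltP (ltn_ord a')).
rewrite col_mxEd !mxE List.app_nth2 lk /=; last by lia.
by rewrite ord1 /= (_ : (k + 0 - k)%coq_nat = 0%N) //; lia.
Qed.

Lemma row_free_usubmx (F : fieldType) k1 k2 l (W : 'M[F]_(k1, l)) (V : 'M_(k2, l)) :
  row_free (col_mx W V) -> row_free W.
Proof.
move=> free; apply: inj_row_free => v vW.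
have /eqP : row_mx v 0 *m col_mx W V = 0 by rewrite mul_row_col vW mul0mx addr0.
by rewrite mulmx_free_eq0 // row_mx_eq0 => /andP[/eqP].
Qed.

(** Steinitz exchange: otherwise all rows of [V] lie in the row space of [W], and [l <= k]. *)
Lemma row_exchange (F : fieldType) k l (W : 'M[F]_(k, l)) (V : 'M_l) :
  (k < l)%N -> row_free W -> row_free V -> exists j, row_free (col_mx W (row j V)).
Proof.
move=> kl freeW freeV; apply/existsP; apply: contraLR kl => /existsPn H.
rewrite -leqNgt -(eqP freeW) -{1}(eqP freeV); apply/mxrankS/row_subP => j.
apply: contraNT (H j) => jW.
have : (\rank W < \rank (W + row j V))%N.
  by rewrite rank_ltmx // /ltmx addsmxSl addsmx_sub submx_refl.
rewrite addsmxE (eqP freeW) => lt.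
by rewrite /row_free eqn_leq rank_leq_row /=; move: lt; lia.
Qed.

Lemma firstn_rcons (T : Type) (M : list T) i d : (i < length M)%N ->
  List.app (List.firstn i M) [:: List.nth i M d] = List.firstn i.+1 M.
Proof. by elim: M i => [|x M IH] [|i] //= lt; rewrite IH. Qed.

Lemma length_powvec n alpha : length (powvec n alpha) = n.
Proof. by rewrite /powvec List.length_map List.length_seq. Qed.

Lemma nth_powvec n alpha j : (j < n)%N ->
  List.nth j (powvec n alpha) 0 = alpha ^+ (n - j).
Proof.
move=> jn; rewrite /powvec.
rewrite (List.nth_indep _ _ ((fun i => pow alpha (n - i)%coq_nat) 0%N)); last first.
  by rewrite List.length_map List.length_seq; apply/ssrnat.ltP.
by rewrite List.map_nth List.seq_nth ?RpowE //; apply/ssrnat.ltP.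
Qed.

Lemma xi_linform n alpha w :
  xi (powvec n alpha) w = linform (powcol alpha n) (rowZ n.+1 w).
Proof.
rewrite /xi length_powvec rsumE linformE big_ord_recr /= !mxE subnn mulr1 -IZR_int.
congr (_ + _); apply: eq_bigr => j _.
by rewrite nth_powvec // !mxE -IZR_int.
Qed.

Lemma finitely_many_lists (T : eqType) (s : seq T) k : exists L : seq (seq T),
  forall l, length l = k -> (forall y, List.In y l -> y \in s) -> List.In l L.
Proof.
elim: k => [|k [L HL]]; first by exists [:: [::]] => -[|x l] // _ _; left.
exists (List.flat_map (fun y => List.map (cons y) L) s) => -[|y l] //= [lk] Hl.
apply/List.in_flat_map; exists y; split.
  have : y \in s by apply: Hl; left.
  elim: (s) => //= z s' IH; rewrite inE => /orP[/eqP->|/IH]; [by left|by right].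
by apply: List.in_map; apply: HL => // z zl; apply: Hl; right.
Qed.

Lemma finite_range_repeats (T : eqType) (f : nat -> T) (L : list T) :
  (forall k, List.In (f k) L) -> exists k k', (k < k')%N /\ f k = f k'.
Proof.
move=> H.
have inL k : f k \in (L : seq T).
  by move: (H k); elim: (L) => //= z s' IH [->|/IH kL];
    rewrite inE ?eqxx // kL orbT.
have lt (k : 'I_(size L).+1) : (index (f k) L < size L)%N by rewrite index_mem.
have /injectivePn[k [k' kk' /(congr1 val)/= E]] :
    ~~ injectiveb (fun k => Ordinal (lt k)).
  by apply/negP => /injectiveP/leq_card; rewrite !card_ord ltnn.
have Ef : f k = f k' by rewrite -(nth_index (f 0%N) (inL k)) E nth_index.
by case: (ltngtP k k') => [||/val_inj] lk; [exists k, k'|exists k', k|rewrite lk eqxx in kk'].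
Qed.

(** * The matrices [A_m]: minimality, and when two of them act equally *)

Section MinkowskiSystems.
Variables (n : nat) (alpha : RR).
Hypothesis indep : powers_Q_indep alpha n.
Local Notation x := (powvec n alpha).
Local Notation lin := (linform (powcol alpha n)).

Lemma is_A_prefix_free m M k : is_A x m M -> (k <= n)%N ->
  row_free (mxQ k.+1 n.+1 (List.firstn k.+1 M)).
Proof.
rewrite /is_A length_powvec => -[lM H] kn.
have [[_ [_ Hi]] _] := H k ltac:(apply/ssrnat.ltP; lia).
rewrite firstn_rcons ?lM ?ltnS // in Hi.
have lk : length (List.firstn k.+1 M) = k.+1 by rewrite List.length_firstn lM; lia.
exact: (proj1 (Q_lin_indepP _ lk) Hi).
Qed.

Lemma is_A_free m M : is_A x m M -> row_free (mxQ n.+1 n.+1 M).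
Proof.
move=> AM; have := is_A_prefix_free AM (leqnn n).
by rewrite List.firstn_all2 // ; case: AM; rewrite length_powvec => -> _; lia.
Qed.

Lemma is_A_row_neq0 m M (i : 'I_n.+1) : is_A x m M -> row i (mxZ n.+1 n.+1 M) != 0.
Proof.
move=> /is_A_free free; apply/eqP => Mi.
have /eqP : (delta_mx 0 i : 'rV[rat]_n.+1) *m mxQ n.+1 n.+1 M = 0.
  by rewrite -rowE -map_row Mi map_mx0.
rewrite mulmx_free_eq0 // => /eqP/rowP/(_ i); rewrite !mxE !eqxx => /eqP.
by rewrite oner_eq0.
Qed.

Lemma supnorm_leP (w : list Z) m :
  supnorm_le n.+1 w m <-> forall j, (`|(rowZ n.+1 w 0 j)%R| <= m)%N.
Proof.
split=> [H j|H j /ssrnat.ltP jn].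
  by have /H := @ssrnat.ltP j n.+1 (ltn_ord j); rewrite mxE; lia.
by have := H (Ordinal jn); rewrite mxE /=; lia.
Qed.

(** By [row_exchange] some row of [V] is independent of the first [i] rows of [M]; being a candidate
    for row [i], it cannot beat the chosen one. *)
Lemma is_A_minimal_system m M : is_A x m M ->
  minimal_system (powcol alpha n) m (mxZ n.+1 n.+1 M).
Proof.
move=> AM; split=> [i|i j|V detV Vm i]; first exact: is_A_row_neq0 AM.
  case: AM => _ /(_ i); rewrite length_powvec => -[|[_ [/supnorm_leP/(_ j) + _]] _].
    exact/ssrnat.ltP.
  by rewrite -row_mxZ mxE.
have [lM H] := AM; rewrite length_powvec in lM H.
have [_ [_ min]] := H i (@ssrnat.ltP i n.+1 (ltn_ord i)).
have lW : length (List.firstn i M) = i.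
  by rewrite List.length_firstn lM; have := ltn_ord i; lia.
have freeW : row_free (mxQ i n.+1 (List.firstn i M)).
  have := is_A_prefix_free AM (ltn_ord i : (i <= n)%N).
  rewrite -(firstn_rcons [::]) ?lM // -addn1 mxQ_rcons //.
  exact: row_free_usubmx.
have freeV : row_free (map_mx intr V : 'M[rat]_n.+1).
  by rewrite row_free_unit unitmxE det_map_mx unitfE intr_eq0.
have [j freej] := row_exchange (ltn_ord i) freeW freeV.
pose v := List.map (fun k => Z_of_int (V j (inord k))) (List.seq 0 n.+1).
have vE : rowZ n.+1 v = row j V.
  apply/rowP => k; rewrite !mxE.
  rewrite (List.nth_indep _ _ ((fun k => Z_of_int (V j (inord k))) 0%N)); last first.
    by rewrite List.length_map List.length_seq; apply/ssrnat.ltP.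
  rewrite List.map_nth List.seq_nth; last exact/ssrnat.ltP.
  by rewrite Z_of_intK inord_val.
exists j; have := min v; rewrite !xi_linform vE -row_mxZ !RabsE => /(_ _)/RleP.
apply; split; first by rewrite List.length_map List.length_seq.
split; first by apply/supnorm_leP => k; rewrite vE mxE.
apply/(@Q_lin_indepP (i + 1)); first by rewrite List.length_app lW.
by rewrite mxQ_rcons // vE map_row.
Qed.

Lemma act_finite (s : seq RR) (M : list (list Z)) :
  (forall i k, lin (row i (mxZ n.+1 n.+1 M)) / lin (row k (mxZ n.+1 n.+1 M)) \in s) ->
  forall y, List.In y (act M x) -> y \in s.
Proof.
move=> Hs y /List.in_map_iff[i [<- /List.in_seq]]; rewrite length_powvec => Hi.
have lt : (i < n.+1)%N by lia.
by have := Hs (Ordinal lt) ord_max; rewrite !row_mxZ -!xi_linform RdivE.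
Qed.

(** The action determines the column of values up to scale; [lambda] is the quotient of the two last
    values, nonzero by independence. *)
Lemma act_eq m m' M M' : is_A x m M -> is_A x m' M' -> act M x = act M' x ->
  exists lambda : RR, map_mx ratr (mxQ n.+1 n.+1 M) *m powcol alpha n =
    lambda *: (map_mx ratr (mxQ n.+1 n.+1 M') *m powcol alpha n).
Proof.
move=> AM AM' /List.ext_in_map E.
have xi0 m0 M0 (i : 'I_n.+1) : is_A x m0 M0 -> xi x (List.nth i M0 [::]) != 0.
  move=> /(is_A_row_neq0 i); apply: contraNneq; rewrite xi_linform -row_mxZ.
  by move/(powcol_indep_int indep)->.
have xiE M0 (i : 'I_n.+1) : (map_mx ratr (mxQ n.+1 n.+1 M0) *m powcol alpha n) i 0 =
    xi x (List.nth i M0 [::]).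
  by rewrite xi_linform -row_mxZ ratr_intr_mx /linform map_row -row_mul [RHS]mxE.
exists (xi x (List.nth n M [::]) / xi x (List.nth n M' [::])).
have z := xi0 _ _ (@ord_max n) AM; have z' := xi0 _ _ (@ord_max n) AM'.
apply/colP => i; rewrite [RHS]mxE !xiE.
have [lt|] := ltnP i n; last first.
  move=> ni; have -> : nat_of_ord i = n by have := ltn_ord i; lia.
  by rewrite divfK.
have /E : List.In (i : nat) (List.seq 0 (length x)).
  by rewrite length_powvec; apply/List.in_seq; lia.
rewrite length_powvec !RdivE => /(canRL (divfK z)) ->.
by rewrite mulrAC [RHS]mulrC mulrA.
Qed.

Lemma is_A_head m M : is_A x m M -> let w := List.nth 0 M [::] in
  [/\ candidate n.+1 m [::] w, first_nonzero_pos n.+1 w &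
     forall v, candidate n.+1 m [::] v -> `|lin (rowZ n.+1 w)| <= `|lin (rowZ n.+1 v)|].
Proof.
case=> _ /(_ 0%N); rewrite length_powvec => -[|Hc [Hp Hm]]; first by lia.
split=> // v /Hm; rewrite !xi_linform !RabsE => /RleP //.
Qed.

(** If [|q| < 1], the first row of [M] has entries no larger than that of [M'] and a strictly
    smaller form, against the minimal choice for [M']. *)
Lemma is_A_scale_ge1 m m' M M' (q : rat) : is_A x m M -> is_A x m' M' ->
  mxQ n.+1 n.+1 M = q *: mxQ n.+1 n.+1 M' -> 1 <= `|q|.
Proof.
move=> AM AM' E; rewrite leNgt; apply/negP => q1.
have [[lw [_ fw]] _ _] := is_A_head AM.
have [[_ [/supnorm_leP Hw' _]] _ min] := is_A_head AM'.
set w := List.nth 0 M _ in lw fw; set w' := List.nth 0 M' _ in Hw' min.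
have Ew : map_mx intr (rowZ n.+1 w) = q *: map_mx intr (rowZ n.+1 w') :> 'rV[rat]_n.+1.
  by have /(congr1 (row 0)) := E; rewrite linearZ /= -!map_row !row_mxZ.
have linE : lin (rowZ n.+1 w) = ratr q * lin (rowZ n.+1 w').
  rewrite /linform -!(ratr_intr_mx (rowZ _ _)) Ew map_mxZ -scalemxAl mxE //.
have : `|lin (rowZ n.+1 w')| <= `|lin (rowZ n.+1 w)|.
  apply: min; split=> //; split=> //; apply/supnorm_leP => j.
  apply: leq_trans (Hw' j); have /rowP/(_ j) := Ew; rewrite !mxE => Ej.
  rewrite -(ler_nat rat) !natr_absz !intr_norm Ej normrM ler_piMl //.
  exact: ltW.
rewrite linE normrM leNgt gtr_pMl.
  by have := q1; rewrite -(ltr_rat RR) rmorph1 /= ratr_norm => ->.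
rewrite normr_gt0; apply: contraNneq (is_A_row_neq0 0 AM').
by rewrite row_mxZ => /(powcol_indep_int indep)->.
Qed.

Lemma first_nonzero_pos_opp (w w' : list Z) :
  first_nonzero_pos n.+1 w -> first_nonzero_pos n.+1 w' ->
  rowZ n.+1 w = - rowZ n.+1 w' -> False.
Proof.
move=> [j [/ssrnat.ltP lj [zj pj]]] [j' [/ssrnat.ltP lj' [zj' pj']]] /rowP E.
have := E (Ordinal lj); have := E (Ordinal lj'); rewrite !mxE /= => E1 E2.
case: (ltngtP j j') => jj.
- by have := zj' j ltac:(lia); lia.
- by have := zj j' ltac:(lia); lia.
- by subst j'; lia.
Qed.

(** Used in both directions, [is_A_scale_ge1] leaves [q = 1] or [q = -1]; the sign normalization of
    the first rows excludes the latter. *)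
Lemma is_A_scale_eq m m' M M' (q : rat) : is_A x m M -> is_A x m' M' ->
  mxQ n.+1 n.+1 M = q *: mxQ n.+1 n.+1 M' -> M = M'.
Proof.
move=> AM AM' E.
have q1 := is_A_scale_ge1 AM AM' E.
have q0 : q != 0 by rewrite -normr_gt0 (lt_le_trans ltr01).
have E' : mxQ n.+1 n.+1 M' = q^-1 *: mxQ n.+1 n.+1 M by rewrite E scalerA mulVf ?scale1r.
have := is_A_scale_ge1 AM' AM E'.
rewrite normfV invf_ge1 ?normr_gt0 // => q1'.
have /eqP : `|q| = 1 by apply/eqP; rewrite eq_le q1' q1.
rewrite eqr_norml ler01 andbT => /orP[] /eqP Eq; last first.
  have [_ Hp _] := is_A_head AM; have [_ Hp' _] := is_A_head AM'.
  case: (first_nonzero_pos_opp Hp Hp').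
  apply/rowP => j; have /matrixP/(_ 0 j) := E.
  rewrite Eq scaleN1r !mxE -mulrNz => /eqP; rewrite eqr_int => /eqP //.
move: E; rewrite Eq scale1r => /matrixP E.
have [lM H] := AM; have [lM' H'] := AM'; rewrite length_powvec in lM lM' H H'.
apply: (List.nth_ext _ _ [::] [::]) => [|i]; rewrite lM ?lM' // => /ssrnat.ltP li.
have [[l1 _] _] := H i ltac:(apply/ssrnat.ltP; done).
have [[l1' _] _] := H' i ltac:(apply/ssrnat.ltP; done).
apply: (List.nth_ext _ _ Z0 Z0) => [|j]; rewrite l1 ?l1' // => /ssrnat.ltP lj.
apply: (can_inj int_of_ZK); apply/eqP; rewrite -(eqr_int rat); apply/eqP.
by have := E (Ordinal li) (Ordinal lj); rewrite !mxE.
Qed.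

Lemma act_eq_algebraic m m' M M' : is_A x m M -> is_A x m' M' -> M <> M' ->
  act M x = act M' x -> root_of_Qpoly_deg_le alpha n.+1.
Proof.
move=> AM AM' MM' /(act_eq AM AM')[lambda E].
have uM' : mxQ n.+1 n.+1 M' \in unitmx by rewrite -row_free_unit; apply: is_A_free AM'.
case: (proportional_systems indep uM' E) => // -[q _ Eq].
by case: MM'; apply: is_A_scale_eq AM AM' Eq.
Qed.

Lemma algebraic_ratios : algebraic_of_degree alpha n.+1 ->
  exists L : list (list RR), forall m M, (0 < m)%N -> is_A x m M -> List.In (act M x) L.
Proof.
move=> /(powcol_mult_struct indep)[D D0 [G HG]].
have [s Hs] := minimal_system_ratios (@powcol_indep_int _ _ indep) D0 HG.
have [L HL] := finitely_many_lists s n.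
exists L => m M m0 AM; apply: HL.
  by rewrite /act List.length_map List.length_seq length_powvec.
by apply: act_finite => i k; apply: Hs m0 (is_A_minimal_system AM) i k.
Qed.

End MinkowskiSystems.

Lemma minkowski_chain_finite n alpha (A B : nat -> list (list Z)) :
  powers_Q_indep alpha n ->
  (forall m, (1 <= m)%coq_nat -> is_A (powvec n alpha) m (A m)) ->
  is_minkowski_chain A B ->
  algebraic_of_degree alpha n.+1 <->
  exists L : list (list RR), forall k, List.In (act (B k) (powvec n alpha)) L.
Proof.
move=> indep HA [idx [idx0 [BE idxS]]].
have idx_gt0 k : (0 < idx k)%N.
  by elim: k => [|k IH]; rewrite ?idx0 //; have [] := idxS k; lia.
have HAidx k : is_A (powvec n alpha) (idx k) (A (idx k)).
  exact: (HA _ (ssrnat.ltP (idx_gt0 k))).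
split=> [/(algebraic_ratios indep)[L HL]|[L HL]].
  by exists L => k; rewrite BE; apply: HL (idx_gt0 k) (HAidx k).
(* Independence excludes an equation of degree at most [n]; it remains to produce one of degree at
   most [n + 1]. *)
split; last first.
  move=> e /ssrnat.ltP en /root_of_Qpoly_deg_leP[p [/eqP p0 sp rp]].
  by apply/p0/(powers_Q_indepP indep _ rp); lia.
(* Finitely many values over an infinite sequence force a repetition, while the chain itself never
   repeats a matrix. *)
have [k [[|k'] [kk' Eact]]] := finite_range_repeats HL; first by [].
rewrite !BE in Eact.
apply: (act_eq_algebraic indep (HAidx _) (HAidx _) _ Eact).
by have [_ [/(_ k) H _]] := idxS k'; move=> /esym; apply: H; lia.
Qed.

End MinkowskiChain.

Theorem theorem2 (n : nat) (alpha : R) (A B : nat -> list (list Z)) :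
  (1 <= n)%nat ->
  powers_Q_indep alpha n ->
  (forall m, (1 <= m)%nat -> is_A (powvec n alpha) m (A m)) ->
  is_minkowski_chain A B ->
  (algebraic_of_degree alpha (S n) <->
   exists L : list (list R), forall k, In (act (B k) (powvec n alpha)) L).
Proof. intros _; apply MinkowskiChain.minkowski_chain_finite. Qed.
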